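(* Let $\{X(t), t\in\mathbb{R}\}$ be a centered stationary Gaussian process with continuous sample paths and covariance function $\gamma(u)=\mathbb{E}\,X(0)X(u)$, normalized so that $\gamma(0)=1$. Assume that $\sum_{j=1}^\infty|\gamma(jb)|<\infty$ for every $b>0$. For $b>0$ put $$\delta(b)=\min_{u\ge 1}\sqrt{2(1-\gamma(ub))},\qquad p(b)=1+\sum_{j=2}^\infty\frac{|2\gamma(jb)-\gamma((j-1)b)-\gamma((j+1)b)|}{2(1-\gamma(b))},$$ (minimum over real $u\ge 1$), and for $a>0$ put $\varepsilon(a)=\min\{b>0:\delta(b)\ge a\}$ (assumed to exist and be positive, with $\gamma(\varepsilon(a))<1$). Then there exists an absolute constant $K>0$ such that for all $T>0$ and $a>0$ with $T\ge\varepsilon(a)$, $$\mathbb{P}\Big\{\sup_{0\le s,t\le T}|X(s)-X(t)|\le a\Big\}\le\exp\Big\{-\frac{KT}{\varepsilon(a)\,p(\varepsilon(a))}\Big\}.$$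
   Context: All Gaussian processes are centered. One may take $K=\frac14\log\frac{\pi}{2}$. *)

(* Defs.v *)
From HB Require Import structures.
From mathcomp Require Import all_boot all_order all_algebra.
From mathcomp Require Import all_classical all_reals all_analysis.
Set Implicit Arguments. Unset Strict Implicit. Unset Printing Implicit Defensive.
Import Order.TTheory GRing.Theory Num.Theory.
Import numFieldNormedType.Exports.
Local Open Scope classical_set_scope.
Local Open Scope ring_scope.

Definition centered_gauss_law {R : realType} (v : R) : set R -> \bar R :=
  if v == 0 then \d_(0 : R) else normal_prob 0 (Num.sqrt v).

Definition centered_gaussian_process {R : realType} {d} {Omega : measurableType d}
  (P : probability Omega R) (X : R -> Omega -> R) : Prop :=
  (forall t, measurable_fun setT (X t)) /\
  forall (n : nat) (ts cs : 'I_n -> R), exists v : R, 0 <= v /\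
    forall A : set R, measurable A ->
      P ((fun w => \sum_(i < n) cs i * X (ts i) w) @^-1` A) = centered_gauss_law v A.

(* (Weak) stationarity with covariance function gamma:
   E[X(s) X(t)] = gamma(t - s); for a Gaussian process this is stationarity. *)
Definition stationary_with_cov {R : realType} {d} {Omega : measurableType d}
  (P : probability Omega R) (X : R -> Omega -> R) (gamma : R -> R) : Prop :=
  forall s t : R, ('E_P[fun w => (X s w * X t w)%R] = (gamma (t - s))%:E)%E.

Definition continuous_paths {R : realType} {Omega : Type} (X : R -> Omega -> R) : Prop :=
  forall w : Omega, continuous (fun t => X t w).

Definition delta_fun {R : realType} (gamma : R -> R) (b : R) : R :=
  inf [set Num.sqrt (2 * (1 - gamma (u * b))) | u in [set u : R | 1 <= u]].

Definition p_fun {R : realType} (gamma : R -> R) (b : R) : R :=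
  1 + limn (fun n => \sum_(2 <= j < n)
      `|2 * gamma (j%:R * b) - gamma ((j.-1)%:R * b) - gamma (j.+1%:R * b)|
        / (2 * (1 - gamma b))).

Definition abs_summable_at {R : realType} (gamma : R -> R) (b : R) : Prop :=
  cvgn (fun n => \sum_(1 <= j < n) `|gamma (j%:R * b)|).

Definition is_eps {R : realType} (gamma : R -> R) (a eps : R) : Prop :=
  0 < eps /\ a <= delta_fun gamma eps /\
  forall b : R, 0 < b -> a <= delta_fun gamma b -> eps <= b.

(* Main.v *)
Require Import Defs.
From HB Require Import structures.
From mathcomp Require Import all_boot all_order all_algebra.
From mathcomp Require Import ring lra zify.
From mathcomp Require Import all_classical all_reals all_analysis measurable_realfun.
Import Order.TTheory GRing.Theory Num.Theory.
Import numFieldNormedType.Exports.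
Local Open Scope classical_set_scope.
Local Open Scope ring_scope.

(** Let [e = eps] and [xi_i = (X((i+1)e) - X(ie)) / sqrt(2 (1 - gamma e))].  On
the small-oscillation event every [|xi_i| <= 1], because [a] is at most
[delta(e)], hence at most the standard deviation of the increments.  The
absolute correlations of [xi_i] with the other increments add up to at most
[2 p(e)], so at least [N / (1 + 16 p(e))] of the [N] increments can be kept in
such a way that the remaining off-diagonal row sums are at most [1/8].

For the kept ones, the indicator of [[-1, 1]] is dominated by a nonnegative
trigonometric polynomial [f].  The expectation of the product of the
[f (xi_i)] expands into expectations of cosines of linear combinations of the
[xi_i], which are Gaussian, so that each cosine has expectation
[exp (- variance / 2)]; by diagonal dominance the variance is at least [7/8] of
its value in the independent case.  Hence the expectation of the product is at
most [q ^ m], with [q < 1] and [m] the number of kept increments. *)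

(** * Gaussian integrals *)

Section normal_stein.
Variables (R : realType) (s : R).
Hypothesis s0 : s != 0.
Notation mu := (@lebesgue_measure R).
Notation g := (normal_pdf 0 s).

(** Completing the square in the exponent. Both the exponential moments and the tail bound for the
    density come from this identity. *)
Lemma normal_pdf_tilt t x :
  expR (t * x) * g x = expR (t ^+ 2 * s ^+ 2 / 2) * normal_pdf (t * s ^+ 2) s x.
Proof.
rewrite !normal_pdfE// mulrCA [RHS]mulrCA; congr (_ * _).
rewrite /normal_fun -!expRD; congr expR; field; exact: s0.
Qed.

Lemma measurable_normal_fun_mul (f : R -> R) : measurable_fun setT f ->
  measurable_fun setT (fun x => f x * g x).
Proof. by move=> mf; apply: measurable_funM => //; exact: measurable_normal_pdf. Qed.

Lemma integrable_expR_normal t :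
  mu.-integrable setT (EFin \o (fun x => expR (t * x) * g x)).
Proof.
rewrite /comp; under eq_fun do rewrite normal_pdf_tilt EFinM.
by apply: integrableZl => //; exact: integrable_normal_pdf.
Qed.

(** Quadratic growth is dominated by a multiple of [expR x + expR (- x)], and each exponential times
    the density is a multiple of a shifted density. *)
Lemma integrable_normal_dom (f : R -> R) (c : R) : measurable_fun setT f ->
  (forall x, `|f x| <= c * (1 + `|x| + x ^+ 2)) ->
  mu.-integrable setT (EFin \o (fun x => f x * g x)).
Proof.
move=> mf fle.
have c0 : 0 <= c.
  by have := le_trans (normr_ge0 _) (fle 0); rewrite normr0 expr0n /= !addr0 mulr1.
apply: (@le_integrable _ _ _ mu setT measurableT _
  (EFin \o (fun x => (4 * c) * (expR (1 * x) * g x + expR (- 1 * x) * g x)))).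
- by apply/measurable_EFinP; exact: measurable_normal_fun_mul.
- move=> x _ /=; rewrite lee_fin normrM (ger0_norm (normal_pdf_ge0 _ _ _)).
  apply: (le_trans _ (ler_norm _)); rewrite -mulrDl mulrA.
  rewrite ler_wpM2r ?normal_pdf_ge0//; apply: (le_trans (fle x)).
  rewrite [4 * c]mulrC -mulrA ler_wpM2l// mul1r mulN1r.
  have h1 := expR_ge1Dx x; have h2 := expR_ge1Dx (- x).
  have p1 := expR_ge0 x; have p2 := expR_ge0 (- x).
  have h3 := @expR_ge1Dxn R `|x| 1 (normr_ge0 _).
  rewrite real_normK ?num_real// (_ : 2`!%:R = 2 :> R)// in h3.
  have h4 : expR `|x| <= expR x + expR (- x) by have [_|_] := ger0P x; lra.
  by move: h3 h4; have [_|_] := ger0P x; lra.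
- rewrite /comp; under eq_fun do rewrite EFinM.
  apply: integrableZl => //; under eq_fun do rewrite EFinD.
  by apply: integrableD => //; exact: integrable_expR_normal.
Qed.

Lemma is_derive_normal_pdf (x : R) : is_derive x (1 : R) g (- (x / s ^+ 2) * g x).
Proof.
rewrite normal_pdfE//.
have -> : (fun x0 => normal_peak s * normal_fun 0 s x0) =
   (fun x : R => normal_peak s * expR (- (s ^+ 2 *+ 2)^-1 * (x * x))).
  apply/funext => y; rewrite /normal_fun; congr (_ * expR _).
  by rewrite subr0 expr2 mulrC mulrN mulNr.
apply: is_derive_eq.
rewrite /GRing.scale /= mulr1 /normal_fun subr0.
rewrite (_ : - x ^+ 2 / _ = - (s ^+ 2 *+ 2)^-1 * (x * x)); last first.
  by rewrite expr2 mulrC mulrN mulNr.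
by field.
Qed.


(** Tilt by [2] times the sign [e] of [x] and bound the shifted density by its peak. The rate [2]
    leaves decay to spare once a factor of linear growth is absorbed. *)
Lemma normal_pdf_le_expR (x : R) :
  g x <= expR (2 * s ^+ 2) * normal_peak s * expR (- (2 * `|x|)).
Proof.
have [e [e2 ex]] : exists e : R, e ^+ 2 = 1 /\ `|x| = e * x.
  have [_|_] := ger0P x; first by exists 1; rewrite expr1n mul1r.
  by exists (-1); rewrite sqrrN expr1n mulN1r.
rewrite expRN ler_pdivlMr ?expR_gt0// mulrC ex mulrA normal_pdf_tilt.
rewrite exprMn e2 mulr1 (_ : 2 ^+ 2 * s ^+ 2 / 2 = 2 * s ^+ 2); last by field.
by rewrite ler_wpM2l ?expR_ge0// normal_pdf_ub.
Qed.

(* Stein's identity: the integrand is the derivative of [f * g], which vanishes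
   at infinity. *)
Lemma integral_stein_normal (f f' : R -> R) (c : R) :
  (forall x, is_derive x (1 : R) f (f' x)) -> continuous f' ->
  (forall x, `|f x| <= c * (1 + `|x|)) -> (forall x, `|f' x| <= c) ->
  \int[mu]_x ((f' x - x / s ^+ 2 * f x) * g x) = 0.
Proof.
move=> df cf' fle f'le.
pose h x := (f' x - x / s ^+ 2 * f x) * g x.
have cf : continuous f.
  by move=> x; apply/differentiable_continuous/derivable1_diffP; have [] := df x.
have c0 : 0 <= c by apply: le_trans (f'le 0).
have ch : continuous h.
  move=> x; apply: cvgM; last exact: continuous_normal_pdf.
  apply: cvgB; first exact: cf'.
  by apply: cvgM; [apply: cvgM; [exact: cvg_id|exact: cvg_cst]|exact: cf].
have dF x : is_derive x (1 : R) (f * g) (h x).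
  have ? := df x; have ? := is_derive_normal_pdf x.
  by apply: is_derive_eq; rewrite /GRing.scale /= /h; ring.
have ih : mu.-integrable setT (EFin \o h).
  apply: (@integrable_normal_dom _ (c * (1 + (s ^+ 2)^-1))).
    apply: continuous_measurable_fun => x; apply: cvgB; first exact: cf'.
    by apply: cvgM; [apply: cvgM; [exact: cvg_id|exact: cvg_cst]|exact: cf].
  move=> x; apply: (le_trans (ler_normB _ _)).
  have s2 : 0 <= (s ^+ 2)^-1 by rewrite invr_ge0 sqr_ge0.
  have h1 := fle x; have h2 := normr_ge0 x; have h3 := f'le x.
  have h4 : x ^+ 2 = `|x| ^+ 2 by rewrite real_normK ?num_real.
  have h5 : 0 <= c * (`|x| + x ^+ 2) by rewrite mulr_ge0// addr_ge0 ?sqr_ge0.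
  have h6 : 0 <= c * (s ^+ 2)^-1 by rewrite mulr_ge0.
  have h7 : `|x| / s ^+ 2 * `|f x| <= `|x| / s ^+ 2 * (c * (1 + `|x|)).
    by rewrite ler_wpM2l// mulr_ge0.
  rewrite !normrM (ger0_norm s2); move: h5 h7; rewrite h4 => h5 h7; lra.
(* The shift to [n.+1] keeps the endpoints distinct for every [n], as the fundamental theorem of
   calculus requires. *)
pose D n := `[- n.+1%:R, n.+1%:R]%classic : set R.
have mh : measurable_fun setT h by exact: continuous_measurable_fun.
have mhD n : measurable_fun setT ((EFin \o h) \_ (D n)).
  apply/(measurable_restrictT _ _).1 => //; first exact: measurable_itv.
  by apply/measurable_funTS/measurable_EFinP.
have hDh x : ((EFin \o h) \_ (D n)) x @[n --> \oo] --> (EFin \o h) x.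
  apply: cvg_near_cst; near=> n.
  rewrite patchE ifT//= inE /D /= in_itv /= -ler_norml.
  apply: (@le_trans _ _ n%:R); last by rewrite ler_nat.
  by near: n; exact: nbhs_infty_ger.
have hDle x n : (`|((EFin \o h) \_ (D n)) x| <= (EFin \o (fun x => `|h x|)%R) x)%E.
  by rewrite patchE /=; case: ifP => _; rewrite /= lee_fin ?normr0.
(* The integrals over [D n] are treated in two ways: dominated convergence sends them to the full
   integral, while the fundamental theorem of calculus turns them into boundary terms, which tend to
   [0]. *)
have [||||| _ _ cv] := @dominated_convergence _ _ _ mu setT measurableT
   (fun n => (EFin \o h) \_ (D n)) (EFin \o h) (EFin \o (fun x => `|h x|)).
- exact: mhD.
- exact/measurable_EFinP.
- by apply: aeW => x _; exact: hDh.
- exact: (integrable_abse ih).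
- by apply: aeW => x n _; exact: hDle.
(* Since [1 + |x| <= expR |x|], the growth of [f] uses up half of the decay rate of [g]. *)
have Fle x : `|f x * g x| <= c * (expR (2 * s ^+ 2) * normal_peak s) * expR (- `|x|).
  rewrite normrM (ger0_norm (normal_pdf_ge0 _ _ _)).
  have := ler_pM (normr_ge0 (f x)) (normal_pdf_ge0 0 s x) (fle x) (normal_pdf_le_expR x).
  move=> /le_trans; apply.
  rewrite (_ : - `|x| = - (2 * `|x|) + `|x|); last by ring.
  rewrite expRD; set C : R := _ * normal_peak s; set E2 : R := expR (- _).
  have C0 : 0 <= c * C * E2 by rewrite !mulr_ge0 ?expR_ge0 ?normal_peak_ge0.
  rewrite [leLHS](_ : _ = c * C * E2 * (1 + `|x|)); last by ring.
  by rewrite mulrA ler_wpM2l// expR_ge1Dx.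
have intD n : (\int[mu]_x ((EFin \o h) \_ (D n)) x =
    (f n.+1%:R * g n.+1%:R - f (- n.+1%:R) * g (- n.+1%:R))%:E)%E.
  rewrite -integral_mkcond EFinB.
  have nn : - n.+1%:R < n.+1%:R :> R by rewrite gtrN.
  apply: (@continuous_FTC2 R h (f * g)) => //.
  - exact: continuous_subspaceT.
  - have cfg x : {for x, continuous (f * g)}.
      by apply/differentiable_continuous/derivable1_diffP; have [] := dF x.
    split.
    + by move=> x _; have [] := dF x.
    + exact/cvg_at_right_filter/cfg.
    + exact/cvg_at_left_filter/cfg.
  - by move=> x _; rewrite derive1E; have [_] := dF x.
have lim0 : (f n.+1%:R * g n.+1%:R - f (- n.+1%:R) * g (- n.+1%:R)) @[n --> \oo] --> (0 : R).
  have cE : (2 * (c * (expR (2 * s ^+ 2) * normal_peak s)) * expR (- n.+1%:R)) @[n --> \oo] --> (0 : R).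
    rewrite -(mulr0 (2 * (c * (expR (2 * s ^+ 2) * normal_peak s)))).
    apply: cvgM; first exact: cvg_cst.
    by have := @cvgn_expR R; rewrite -(cvg_shiftS (fun n => expR (- n%:R) : R)).
  apply: norm_cvg0; apply: (squeeze_cvgr _ (cvg_cst (0 : R)) cE).
  near=> n; rewrite normr_ge0 /=; apply: (le_trans (ler_normB _ _)).
  rewrite -mulrA mulr2n mulrDl mul1r; apply: lerD.
    by apply: (le_trans (Fle _)); rewrite normr_nat.
  by apply: (le_trans (Fle _)); rewrite normrN normr_nat.
have : (\int[mu]_x (EFin \o h) x = 0)%E.
  rewrite -(cvg_lim _ cv)//; apply/cvg_lim => //.
  rewrite (_ : (fun n => _) = EFin \o (fun n => f n.+1%:R * g n.+1%:R - f (- n.+1%:R) * g (- n.+1%:R))); last by apply/funext => n /=; rewrite intD.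
  by apply: cvg_EFin; [exact: nearW|exact: lim0].
by rewrite /Rintegral => ->.
Unshelve. all: by end_near. Qed.

End normal_stein.

(** * Second moment and characteristic function of a centered Gaussian density *)

Section normal_moments.
Variables (R : realType) (s : R).
Hypothesis s0 : s != 0.
Notation mu := (@lebesgue_measure R).
Notation g := (normal_pdf 0 s).

Lemma Rintegral_normal_pdf : \int[mu]_x g x = 1.
Proof. by rewrite /Rintegral integral_normal_pdf. Qed.

Lemma integrable_sqr_normal : mu.-integrable setT (EFin \o (fun x => x ^+ 2 * g x)).
Proof.
apply: (@integrable_normal_dom _ _ s0 (fun x => x ^+ 2) 1); first exact: exprn_measurable.
move=> x; rewrite mul1r ger0_norm ?sqr_ge0//.
by rewrite lerDr addr_ge0.
Qed.

(** Stein's identity for the identity function. *)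
Lemma Rintegral_sqr_normal : \int[mu]_x (x ^+ 2 * g x) = s ^+ 2.
Proof.
have st : \int[mu]_x ((1 - x / s ^+ 2 * id x) * g x) = 0.
  apply: (@integral_stein_normal _ _ s0 id (fun=> 1) 1).
  - by move=> x; apply: cvg_cst.
  - by move=> x; rewrite mul1r lerDr.
  - by move=> x; rewrite normr1.
have s2 : s ^+ 2 != 0 by rewrite expf_neq0.
have : \int[mu]_x (g x - (s ^+ 2)^-1 * (x ^+ 2 * g x)) = 0.
  by rewrite -[RHS]st; apply: eq_Rintegral => x _ /=; ring.
rewrite RintegralB//; first last.
- rewrite /comp; under eq_fun do rewrite EFinM.
  by apply: integrableZl => //; exact: integrable_sqr_normal.
- exact: integrable_normal_pdf.
rewrite RintegralZl//; last exact: integrable_sqr_normal.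
rewrite Rintegral_normal_pdf => /eqP; rewrite subr_eq0 => /eqP h.
by rewrite -[LHS](mulVKf s2) -h mulr1.
Qed.

Lemma integrable_cos_normal t :
  mu.-integrable setT (EFin \o (fun x => cos (t * x) * g x)).
Proof.
apply: (@integrable_normal_dom _ _ s0 _ 1) => //.
  apply: continuous_measurable_fun => x.
  apply: (@continuous_comp _ _ _ (fun x => t * x)); last exact: continuous_cos.
  exact: mulrl_continuous.
move=> x; rewrite mul1r (le_trans (cos_max _))//.
by rewrite -addrA lerDl addr_ge0 ?sqr_ge0.
Qed.

Let phi t := \int[mu]_x (cos (t * x) * g x).

(** Differentiation under the integral sign gives the integral of [- x * sin (t * x) * g x]; Stein's
    identity for [sin (t * x)] expresses it through [phi t] again. *)
Let dphi t : is_derive t (1 : R) phi (- (s ^+ 2 * t * phi t)).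
Proof.
have s2 : s ^+ 2 != 0 by rewrite expf_neq0.
have d1 (x y : R) : is_derive x (1 : R) (fun t => cos (t * y) * g y) (- (y * sin (x * y) * g y)).
  have ? := is_derive_cos (x * y).
  have ? : is_derive x (1 : R) (fun t => t * y) y.
    by apply: is_derive_eq; rewrite /GRing.scale /= mulr0 mulr1 add0r.
  have ? : is_derive x (1 : R) (fun t => cos (t * y)) (- sin (x * y) * y).
    exact: is_derive1_comp.
  by apply: is_derive_eq; rewrite /GRing.scale /=; ring.
have It : `]t - 1, t + 1[%classic t by rewrite /= in_itv /= gtrBl ltrDl ltr01.
have ig : mu.-integrable setT (EFin \o (fun x : R => `|x| * g x)).
  apply: (@integrable_normal_dom _ _ s0 _ 1) => // x.
  by rewrite normr_id mul1r -addrA addrCA lerDl addr_ge0 ?sqr_ge0.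
have dom (x y : R) : `]t - 1, t + 1[%classic x -> [set: R] y ->
    `|partial1of2 (fun t y => cos (t * y) * g y) x y| <= `|y| * g y.
  move=> _ _; rewrite partial1of2E; have [_ ->] := d1 x y.
  rewrite normrN normrM (ger0_norm (normal_pdf_ge0 _ _ _)) ler_wpM2r ?normal_pdf_ge0//.
  by rewrite normrM ler_piMr// sin_max.
have der (x y : R) : `]t - 1, t + 1[%classic x -> [set: R] y ->
    derivable (fun t : R => cos (t * y) * g y) x (1 : R) by move=> _ _; have [] := d1 x y.
have G0 (y : R) : 0 <= `|y| * g y by rewrite mulr_ge0 ?normal_pdf_ge0.
have int (x : R) : `]t - 1, t + 1[%classic x ->
    mu.-integrable setT (EFin \o (fun y => cos (x * y) * g y)).
  by move=> _; exact: integrable_cos_normal.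
apply: DeriveDef.
  exact: (derivable_under_integral measurableT It int der G0 ig dom).
rewrite -derive1E (differentiation_under_integral measurableT It int der G0 ig dom).
have st : \int[mu]_x ((t * cos (t * x) - x / s ^+ 2 * sin (t * x)) * g x) = 0.
  apply: (@integral_stein_normal _ _ s0 (fun x => sin (t * x)) (fun x => t * cos (t * x)) (1 + `|t|)).
  - move=> x; have ? := is_derive_sin (t * x).
    have ? : is_derive x (1 : R) (fun x => t * x) t.
      by apply: is_derive_eq; rewrite /GRing.scale /= mulr1.
    rewrite mulrC; exact: is_derive1_comp.
  - move=> x; apply: cvgM; first exact: cvg_cst.
    apply: (@continuous_comp _ _ _ (fun x => t * x)); last exact: continuous_cos.
    exact: mulrl_continuous.
  - move=> x; apply: (le_trans (sin_max _)).
    by rewrite -[leLHS]mulr1 ler_pM// lerDl.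
  - move=> x; rewrite normrM; apply: (@le_trans _ _ `|t|); last by rewrite lerDr.
    by rewrite ler_piMr// cos_max.
transitivity (\int[mu]_x (s ^+ 2 * ((t * cos (t * x) - x / s ^+ 2 * sin (t * x)) * g x)
    - s ^+ 2 * t * (cos (t * x) * g x))).
  apply: eq_Rintegral => y _; rewrite partial1of2E; have [_ ->] := d1 t y.
  by field.
have ic : mu.-integrable setT
   (EFin \o (fun x => s ^+ 2 * t * (cos (t * x) * g x))).
  rewrite /comp; under eq_fun do rewrite EFinM.
  by apply: integrableZl => //; exact: integrable_cos_normal.
have ist : mu.-integrable setT
   (EFin \o (fun x => (t * cos (t * x) - x / s ^+ 2 * sin (t * x)) * g x)).
  apply: (@integrable_normal_dom _ _ s0 _ (`|t| + (s ^+ 2)^-1)).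
    apply: continuous_measurable_fun => x.
    have ct : continuous (fun x : R => t * x) by exact: mulrl_continuous.
    apply: cvgB; apply: cvgM.
    - exact: cvg_cst.
    - by apply: (@continuous_comp _ _ _ (fun x => t * x)); [exact: ct|exact: continuous_cos].
    - by apply: cvgM; [exact: cvg_id|exact: cvg_cst].
    - by apply: (@continuous_comp _ _ _ (fun x => t * x)); [exact: ct|exact: continuous_sin].
  move=> x; apply: (le_trans (ler_normB _ _)); rewrite !normrM.
  have i2 : 0 <= (s ^+ 2)^-1 by rewrite invr_ge0 sqr_ge0.
  rewrite (ger0_norm i2) [leRHS]mulrDl; apply: lerD.
    by rewrite ler_wpM2l// (le_trans (cos_max _))// -addrA lerDl addr_ge0 ?sqr_ge0.
  rewrite [_ * (s ^+ 2)^-1]mulrC -mulrA ler_wpM2l//.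
  apply: (@le_trans _ _ `|x|); first by rewrite ler_piMr// sin_max.
  by rewrite -addrA addrCA lerDl addr_ge0 ?sqr_ge0.
rewrite RintegralB//; last first.
  rewrite /comp; under eq_fun do rewrite EFinM.
  exact: integrableZl.
rewrite !RintegralZl//; last exact: integrable_cos_normal.
by rewrite st mulr0 add0r.
Qed.

(** By the differential equation [dphi], the product of [phi t] with [expR (s ^+ 2 * t ^+ 2 / 2)]
    has zero derivative, and it equals [1] at [0]. *)
Lemma Rintegral_cos_normal t :
  \int[mu]_x (cos (t * x) * g x) = expR (- (s ^+ 2 * t ^+ 2 / 2)).
Proof.
rewrite -/(phi t).
have d (x : R) : is_derive x (1 : R) (fun t => phi t * expR (s ^+ 2 / 2 * (t * t))) 0.
  have ? := dphi x.
  have ? : is_derive x (1 : R) (fun t => s ^+ 2 / 2 * (t * t)) (s ^+ 2 * x).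
    by apply: is_derive_eq; rewrite /GRing.scale /=; field.
  have ? := is_derive_expR (s ^+ 2 / 2 * (x * x)).
  have ? : is_derive x (1 : R) (fun t => expR (s ^+ 2 / 2 * (t * t)))
      (expR (s ^+ 2 / 2 * (x * x)) * (s ^+ 2 * x)) by exact: is_derive1_comp.
  by apply: is_derive_eq; rewrite /GRing.scale /=; ring.
have := is_derive_0_is_cst t 0 d.
have -> : phi 0 = 1.
  by rewrite -Rintegral_normal_pdf; apply: eq_Rintegral => x _; rewrite mul0r cos0 mul1r.
rewrite !mul0r mulr0 expR0 mulr1 => h.
rewrite expRN (_ : s ^+ 2 * t ^+ 2 / 2 = s ^+ 2 / 2 * (t * t)); last by field.
by apply: (mulIf (lt0r_neq0 (expR_gt0 (s ^+ 2 / 2 * (t * t))))); rewrite h mulVf// gt_eqF// expR_gt0.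
Qed.

End normal_moments.

(** * Gaussian random variables *)

(** The Radon-Nikodym derivative of [normal_prob] and the explicit density have the same integral
    over every measurable set, hence agree almost everywhere. *)
Lemma ge0_integral_normal_prob (R : realType) (m s : R) (f : R -> \bar R) :
  measurable_fun setT f -> (forall x, 0 <= f x)%E ->
  (\int[normal_prob m s]_x f x =
   \int[lebesgue_measure]_x (f x * (normal_pdf m s x)%:E))%E.
Proof.
move=> mf f0; have dom := normal_prob_dominates m s.
rewrite -(Radon_Nikodym_SigmaFinite.change_of_variables dom f0 measurableT mf).
have iRN := Radon_Nikodym_SigmaFinite.f_integrable dom.
apply: ae_eq_integral => //.
- by apply: emeasurable_funM => //; exact: (measurable_int _ iRN).
- apply: emeasurable_funM => //; apply/measurable_EFinP.
  exact: measurable_normal_pdf.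
- apply: ae_eqe_mul2l; apply: integral_ae_eq => //.
    by apply/measurable_EFinP; exact: measurable_normal_pdf.
  by move=> E _ mE; rewrite -Radon_Nikodym_SigmaFinite.f_integral.
Qed.

Lemma Rintegral_probability_cst {d} {T : measurableType d} {R : realType}
  (P : probability T R) (r : R) : \int[P]_w r = r.
Proof.
by rewrite Rintegral_cst// [X in fine X](@probability_setT _ _ _ P) mulr1.
Qed.

Section law.
Context {d} {T : measurableType d} {R : realType} (P : probability T R).
Variables (S : T -> R) (v : R).
Hypotheses (mS : measurable_fun setT S) (v0 : 0 <= v).
Hypothesis lawS : forall A, measurable A -> P (S @^-1` A) = centered_gauss_law v A.

Lemma ge0_integral_law (nu : {measure set (measurableTypeR R) -> \bar R}) (f : R -> R) :
  (forall A, measurable A -> P (S @^-1` A) = nu A) ->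
  measurable_fun setT f -> (forall x, 0 <= f x) ->
  (\int[P]_w (f (S w))%:E = \int[nu]_x (f x)%:E)%E.
Proof.
move=> law mf f0.
have mEf : measurable_fun setT (EFin \o f) by exact/measurable_EFinP.
have := @ge0_integral_pushforward _ _ T (measurableTypeR R) _ _ mS P setT (EFin \o f) measurableT.
rewrite preimage_setT => <-//; last by move=> x _; rewrite lee_fin.
by apply: eq_measure_integral => A mA _; rewrite -law.
Qed.

(** The two premises on [v] separate the Dirac mass at [0] from the law with a density.
    Nonnegativity of [f] permits the change of variables before integrability is known; the latter
    then follows from the value being finite. *)
Lemma Rintegral_gauss_law (f : R -> R) (c : R) :
  measurable_fun setT f -> (forall x, 0 <= f x) ->
  (v = 0 -> f 0 = c) ->
  (v != 0 -> lebesgue_measure.-integrable setT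
               (EFin \o (fun x => f x * normal_pdf 0 (Num.sqrt v) x)) /\
             \int[lebesgue_measure]_x (f x * normal_pdf 0 (Num.sqrt v) x) = c) ->
  P.-integrable setT (EFin \o (f \o S)) /\ \int[P]_w f (S w) = c.
Proof.
move=> mf f0 h0 h1.
suff h : (\int[P]_w (f (S w))%:E = c%:E)%E.
  split; last by rewrite /Rintegral h.
  apply/integrableP; split.
    by apply/measurable_EFinP; exact: measurableT_comp.
  under eq_integral do rewrite /= ger0_norm//.
  by rewrite h ltry.
move: lawS; rewrite /centered_gauss_law.
have [vz law|vn0 law] := eqVneq v 0; [rewrite -(h0 vz)|have [ifg <-] := h1 vn0].
  rewrite (ge0_integral_law (dirac (0 : measurableTypeR R)) f law)// integral_dirac//.
    by rewrite diracT mul1e.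
  exact/measurable_EFinP.
rewrite (ge0_integral_law (normal_prob 0 (Num.sqrt v)) f law)//.
rewrite ge0_integral_normal_prob//.
  by rewrite /Rintegral fineK// integrable_fin_num.
exact/measurable_EFinP.
Qed.

Lemma gauss_law_sqr :
  P.-integrable setT (EFin \o (fun w => S w ^+ 2)) /\ \int[P]_w (S w ^+ 2) = v.
Proof.
apply: (Rintegral_gauss_law (fun x => x ^+ 2)).
- exact: exprn_measurable.
- by move=> x; exact: sqr_ge0.
- by move=> ->; rewrite expr0n.
- move=> vn0; have s0 : Num.sqrt v != 0 by rewrite sqrtr_eq0 -ltNge lt_neqAle eq_sym vn0.
  split; first exact: integrable_sqr_normal.
  by rewrite Rintegral_sqr_normal// sqr_sqrtr.
Qed.

(** [Rintegral_gauss_law] asks for a nonnegative function, so it is applied to [1 + cos] and the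
    constant is subtracted afterwards. *)
Lemma gauss_law_cos : \int[P]_w cos (S w) = expR (- (v / 2)).
Proof.
have mcos : measurable_fun setT (@cos R) by apply: continuous_measurable_fun; exact: continuous_cos.
have [i1 e1] : P.-integrable setT (EFin \o ((fun x => 1 + cos x) \o S)) /\
    \int[P]_w (1 + cos (S w)) = 1 + expR (- (v / 2)).
  apply: (Rintegral_gauss_law (fun x => 1 + cos x)).
  - exact: measurable_funD.
  - by move=> x; rewrite -lerBlDl sub0r cos_geN1.
  - by move=> ->; rewrite cos0 mul0r oppr0 expR0.
  - move=> vn0; have s0 : Num.sqrt v != 0 by rewrite sqrtr_eq0 -ltNge lt_neqAle eq_sym vn0.
    have ic := @integrable_cos_normal R _ s0 1.
    have ig := @integrable_normal_pdf R 0 (Num.sqrt v).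
    have eqf : (fun x => (1 + cos x) * normal_pdf 0 (Num.sqrt v) x) =
      (fun x => normal_pdf 0 (Num.sqrt v) x + cos (1 * x) * normal_pdf 0 (Num.sqrt v) x).
      by apply/funext => x; rewrite mul1r mulrDl mul1r.
    rewrite eqf; split.
      by rewrite /comp; under eq_fun do rewrite EFinD; exact: integrableD.
    rewrite RintegralD// Rintegral_normal_pdf Rintegral_cos_normal//.
    by rewrite sqr_sqrtr// expr1n mulr1.
have i0 : P.-integrable setT (EFin \o (fun _ : T => 1 : R)).
  exact: finite_measure_integrable_cst.
transitivity (\int[P]_w ((1 + cos (S w)) - 1)).
  by apply: eq_Rintegral => w _; rewrite addrC addKr.
rewrite RintegralB// e1 Rintegral_probability_cst.
by rewrite addrC addKr.
Qed.

End law.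

(** * Sparse subsets and diagonal dominance *)

(** Take [I] maximizing [G]. Removing a point of [I] does not increase [G], so its row sum over [I]
    is at most [eta]; adding an outside point does not increase [G] either, so its row sum over [I]
    is at least [eta]. Summing the latter over the complement and exchanging the sums bounds
    [eta * #|~: I|] by [B * #|I|]. *)
Lemma exists_sparse_subset (R : realFieldType) (T : finType) (A : T -> T -> R)
    (B eta : R) :
  (forall i j, A i j = A j i) -> (forall i j, 0 <= A i j) ->
  (forall i, A i i = 0) -> (forall i, \sum_j A i j <= B) ->
  exists I : {set T}, (forall i, i \in I -> \sum_(j in I) A i j <= eta) /\
    eta * #|T|%:R <= (eta + B) * #|I|%:R.
Proof.
move=> sA A0 Ad AB.
(* The factor [2] matches the double sum, in which every pair occurs in both orders. *)
pose G (J : {set T}) := 2 * eta * #|J|%:R - \sum_(i in J) \sum_(j in J) A i j.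
have GU i (J : {set T}) : i \notin J ->
    G (i |: J) = G J + 2 * (eta - \sum_(j in J) A i j).
  move=> iJ; rewrite /G cardsU1 iJ natrD big_setU1//= big_setU1//= Ad add0r.
  have -> : \sum_(k in J) \sum_(j in i |: J) A k j =
      \sum_(k in J) A i k + \sum_(k in J) \sum_(j in J) A k j.
    by rewrite -big_split; apply: eq_bigr => k _; rewrite big_setU1//= sA.
  by ring.
have [I IG] : exists I : {set T}, forall J, G J <= G I.
  have [I _ Imax] := @Order.TotalTheory.arg_maxP _ _ _ (finset.set0 : {set T}) xpredT G isT.
  by exists I => J; exact: Imax.
have le_in i : i \in I -> \sum_(j in I) A i j <= eta.
  move=> iI; have iD : i \notin I :\ i by rewrite !inE eqxx.
  have := IG (I :\ i); rewrite -[in G I](finset.setD1K iI) GU// => h.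
  rewrite (big_setD1 i)//= Ad add0r; lra.
have ge_out i : i \notin I -> eta <= \sum_(j in I) A i j.
  by move=> iI; have := IG (i |: I); rewrite GU// => h; lra.
exists I; split => //.
have h1 : \sum_(i in ~: I) eta <= \sum_(i in ~: I) \sum_(j in I) A i j.
  by apply: ler_sum => i; rewrite inE; exact: ge_out.
have h2 : \sum_(i in ~: I) \sum_(j in I) A i j <= \sum_(j in I) B.
  rewrite exchange_big; apply: ler_sum => j _; apply: le_trans (AB j).
  rewrite [leRHS](bigID (mem (~: I)))/=.
  rewrite (eq_bigr (fun i => A j i)); last by move=> i _; exact: sA.
  by rewrite lerDl sumr_ge0.
have := le_trans h1 h2; rewrite !sumr_const => h3.
have : #|I|%:R + #|~: I|%:R = #|T|%:R :> R by rewrite -natrD cardsC.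
by move: h3; rewrite -(mulr_natr eta) -(mulr_natr B) => h3 <-; rewrite mulrDr mulrDl lerD2l.
Qed.

(** Each off-diagonal term is at least [- A i j * (w i ^+ 2 + w j ^+ 2) / 2]. By symmetry of [A] the
    two halves have equal sums, so the total loss at [i] is its row sum times [w i ^+ 2]. *)
Lemma diag_dominant_form_ge (R : realFieldType) (T : finType) (I : {set T})
    (C A : T -> T -> R) (eta : R) (w : T -> R) :
  (forall i j, A i j = A j i) -> (forall i, A i i = 0) ->
  (forall i, C i i = 1) -> (forall i j, i != j -> `|C i j| <= A i j) ->
  (forall i, i \in I -> \sum_(j in I) A i j <= eta) ->
  (1 - eta) * \sum_(i in I) w i ^+ 2 <=
  \sum_(i in I) \sum_(j in I) w i * w j * C i j.
Proof.
move=> sA Ad Cd CA AI.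
have h i j : (j == i)%:R * w i ^+ 2 - (A i j * w i ^+ 2 + A i j * w j ^+ 2) / 2 <=
    w i * w j * C i j.
  have [->|ji] := eqVneq j i; first by rewrite Ad Cd /= expr2; lra.
  have CAij : `|C i j| <= A i j by apply: CA; rewrite eq_sym.
  have amgm : `|w i * w j| <= (w i ^+ 2 + w j ^+ 2) / 2.
    rewrite ler_norml; have := sqr_ge0 (w i - w j); have := sqr_ge0 (w i + w j).
    by rewrite sqrrB sqrrD => h1 h2; apply/andP; split; lra.
  rewrite mul0r sub0r -mulrDr -mulrA lerNl; apply: le_trans (ler_norm _) _.
  by rewrite normrN normrM [leLHS]mulrC ler_pM.
have -> : (1 - eta) * \sum_(i in I) w i ^+ 2 =
    \sum_(i in I) w i ^+ 2 - \sum_(i in I) eta * w i ^+ 2.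
  by rewrite -mulr_sumr; ring.
have h1 : \sum_(i in I) \sum_(j in I) A i j * w i ^+ 2 <= \sum_(i in I) eta * w i ^+ 2.
  by apply: ler_sum => i iI; rewrite -mulr_suml ler_wpM2r ?sqr_ge0// AI.
have h2 : \sum_(i in I) \sum_(j in I) A i j * w j ^+ 2 =
    \sum_(i in I) \sum_(j in I) A i j * w i ^+ 2.
  rewrite exchange_big; apply: eq_bigr => i _; apply: eq_bigr => j _.
  by rewrite sA.
have h3 : \sum_(i in I) \sum_(j in I) (j == i)%:R * w i ^+ 2 = \sum_(i in I) w i ^+ 2.
  apply: eq_bigr => i iI; rewrite (bigD1 i)//= eqxx mul1r big1 ?addr0// => j /andP[_ ji].
  by rewrite (negbTE ji) mul0r.
have : \sum_(i in I) \sum_(j in I) ((j == i)%:R * w i ^+ 2 -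
    (A i j * w i ^+ 2 + A i j * w j ^+ 2) / 2) <=
  \sum_(i in I) \sum_(j in I) w i * w j * C i j.
  by apply: ler_sum => i _; apply: ler_sum => j _; exact: h.
apply: le_trans.
rewrite [leRHS](_ : _ = \sum_(i in I) \sum_(j in I) (j == i)%:R * w i ^+ 2 -
  (\sum_(i in I) \sum_(j in I) A i j * w i ^+ 2 +
   \sum_(i in I) \sum_(j in I) A i j * w j ^+ 2) / 2); last first.
  rewrite -big_split mulr_suml -sumrB; apply: eq_bigr => i _ /=.
  by rewrite -big_split mulr_suml -sumrB; apply: eq_bigr => j _.
rewrite h3 h2; lra.
Qed.

(** * Elementary bounds on sine and cosine *)

Lemma ler_norm_sin (R : realType) (u : R) : `|sin u| <= `|u|.
Proof.
wlog u0 : u / 0 <= u.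
  move=> H; case: (leP 0 u) => [/H//|u0].
  by have := H (- u); rewrite sinN !normrN; apply; rewrite oppr_ge0 ltW.
have ds (x : R) : x \in `]0, u[%R -> is_derive x (1 : R) sin (cos x) by move=> _; exact: is_derive_sin.
have cs : {within `[0, u], continuous (@sin R)}.
  exact/continuous_subspaceT/continuous_sin.
have [c _] := MVT_segment u0 ds cs.
rewrite sin0 !subr0 => ->; rewrite normrM.
by rewrite ler_piMl// cos_max.
Qed.

Lemma cos_ge_1Bsqr (R : realType) (x : R) : 1 - x ^+ 2 / 2 <= cos x.
Proof.
have -> : cos x = 1 - 2 * sin (x / 2) ^+ 2.
  by rewrite [in LHS](splitr x) -mulr2n cos_mulr2n cos2sin2 -mulr_natl; ring.
have h : sin (x / 2) ^+ 2 <= (x / 2) ^+ 2.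
  rewrite -[leLHS]real_normK ?num_real// -[leRHS]real_normK ?num_real//.
  by rewrite ler_sqr ?nnegrE// ler_norm_sin.
move: h; rewrite (_ : (x / 2) ^+ 2 = x ^+ 2 / 4); last by field.
lra.
Qed.

(** * A trigonometric majorant *)

(* In the variable [y = cos (6 x / 5)] this is [(1 + y) (9 - 4 y) / 10], which
   is nonnegative on [[-1, 1]] and at least [1] on [[1/4, 1]]. *)
Definition trig_bump {R : realType} (x : R) : R :=
  7 / 10 + cos (6 / 5 * x) / 2 - cos (12 / 5 * x) / 5.

Lemma trig_bumpE (R : realType) (x : R) :
  trig_bump x = (1 + cos (6 / 5 * x)) * (9 - 4 * cos (6 / 5 * x)) / 10.
Proof.
rewrite /trig_bump (_ : 12 / 5 * x = (6 / 5 * x) *+ 2); last first.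
  by rewrite -mulr_natl; field.
by rewrite cos_mulr2n -mulr_natl; field.
Qed.

Lemma trig_bump_ge0 (R : realType) (x : R) : 0 <= trig_bump x.
Proof.
rewrite trig_bumpE; have h1 := cos_geN1 (6 / 5 * x); have h2 := cos_le1 (6 / 5 * x).
by rewrite divr_ge0// mulr_ge0//; lra.
Qed.

Lemma trig_bump_le2 (R : realType) (x : R) : trig_bump x <= 2.
Proof.
rewrite /trig_bump.
have h1 := cos_geN1 (12 / 5 * x); have h2 := cos_le1 (6 / 5 * x); lra.
Qed.

Lemma trig_bump_ge1 (R : realType) (x : R) : `|x| <= 1 -> 1 <= trig_bump x.
Proof.
move=> x1; rewrite trig_bumpE; set y := cos _.
have y1 : y <= 1 := cos_le1 _.
have x2 : x ^+ 2 <= 1 by rewrite -[leLHS]real_normK ?num_real// expr_le1.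
(* The frequency [6/5] is small enough: [1 - (6/5)^2 / 2 = 7/25], which exceeds [1/4]. The
   conclusion then follows from [(1 + y) (9 - 4 y) - 10 = (1 - y) (4 y - 1)]. *)
have y2 : 1 / 4 <= y.
  by have := cos_ge_1Bsqr _ (6 / 5 * x); rewrite exprMn -/y; lra.
nra.
Qed.

Lemma continuous_trig_bump (R : realType) : continuous (@trig_bump R).
Proof.
have cc (a : R) : continuous (fun x => cos (a * x)).
  move=> x; apply: (@continuous_comp _ _ _ (fun x => a * x)); last exact: continuous_cos.
  exact: mulrl_continuous.
move=> x; apply: cvgB; [apply: cvgD; [exact: cvg_cst|]|].
  by apply: cvgM; [exact: cc|exact: cvg_cst].
by apply: cvgM; [exact: cc|exact: cvg_cst].
Qed.

(** Product-to-sum formula. The sum is nested to the right to suit repeated use of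
    [Rintegral_linear]. *)
Lemma trig_bump_cos (R : realType) (a x : R) :
  cos a * trig_bump x =
  7 / 10 * cos a +
  (1 / 4 * cos (a + 6 / 5 * x) + (1 / 4 * cos (a + - (6 / 5) * x) +
  (- (1 / 10) * cos (a + 12 / 5 * x) + - (1 / 10) * cos (a + - (12 / 5) * x)))).
Proof.
by rewrite /trig_bump !mulNr !cosD !cosN !sinN; field.
Qed.

(** * Expectation of a product of bumps *)

Section product.
Context {d} {Omega : measurableType d} {R : realType} (P : probability Omega R).

Lemma integrable_bounded (f : Omega -> R) (c : R) :
  measurable_fun setT f -> (forall w, `|f w| <= c) ->
  P.-integrable setT (EFin \o f).
Proof.
move=> mf fc; apply: (@le_integrable _ _ _ P setT measurableT _ (EFin \o cst c)).
- exact/measurable_EFinP.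
- by move=> w _ /=; rewrite lee_fin (le_trans (fc w))// ler_norm.
- exact: finite_measure_integrable_cst.
Qed.

Lemma Rintegral_linear (f g : Omega -> R) (a : R) :
  P.-integrable setT (EFin \o f) -> P.-integrable setT (EFin \o g) ->
  P.-integrable setT (EFin \o (fun w => a * f w + g w)) /\
  \int[P]_w (a * f w + g w) = a * \int[P]_w f w + \int[P]_w g w.
Proof.
move=> hf hg.
have haf : P.-integrable setT (EFin \o (fun w => a * f w)).
  by rewrite /comp; under eq_fun do rewrite EFinM; exact: integrableZl.
split; last by rewrite RintegralD// RintegralZl.
by rewrite /comp; under eq_fun do rewrite EFinD; exact: integrableD.
Qed.

Variables (T : finType) (xi : T -> Omega -> R) (I : {set T}) (c r : R).
Hypothesis mxi : forall i, measurable_fun setT (xi i).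
Hypothesis charfun_le : forall w : T -> R,
  `|\int[P]_z cos (\sum_(i in I) w i * xi i z)| <=
  expR (- (c * \sum_(i in I) w i ^+ 2)).
Hypothesis rE : r = expR (- (c * (6 / 5) ^+ 2)).

Let lin (w : T -> R) z := \sum_(i in I) w i * xi i z.
Let bump (s : seq T) z := \prod_(i <- s) trig_bump (xi i z).
(** Sum of the absolute values of the five coefficients in [trig_bump_cos], each times the decay
    factor of its frequency: [1], then [r] twice, then [r ^+ 4] twice, because
    [(12/5)^2 = 4 (6/5)^2]. *)
Let q := 7 / 10 + r / 2 + r ^+ 4 / 5.

Let mlin w : measurable_fun setT (lin w).
Proof.
rewrite (_ : lin w = fun z => \sum_(i <- enum I) w i * xi i z); last first.
  by apply/funext => z; rewrite big_enum.
apply: measurable_sum => i; apply: measurable_funM => //; exact: measurable_cst.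
Qed.

Let mbump s : measurable_fun setT (bump s).
Proof.
apply: measurable_prod => i _; apply: measurableT_comp => //.
apply: continuous_measurable_fun; exact: continuous_trig_bump.
Qed.

Let bump_ge0 s z : 0 <= bump s z.
Proof. by apply: prodr_ge0 => i _; exact: trig_bump_ge0. Qed.

Let bump_le s z : bump s z <= 2 ^+ size s.
Proof.
rewrite /bump; elim: s => [|i s IH]; first by rewrite big_nil expr0.
rewrite big_cons exprS ler_pM// ?trig_bump_ge0 ?trig_bump_le2//.
exact: bump_ge0.
Qed.

Let mcoslin w : measurable_fun setT (fun z => cos (lin w z)).
Proof.
apply: measurableT_comp; last exact: mlin.
apply: continuous_measurable_fun; exact: continuous_cos.
Qed.

Let icos w s : P.-integrable setT (EFin \o (fun z => cos (lin w z) * bump s z)).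
Proof.
apply: (@integrable_bounded _ (2 ^+ size s)).
  by apply: measurable_funM; [exact: mcoslin|exact: mbump].
move=> z; rewrite normrM (ger0_norm (bump_ge0 s z)).
by apply: le_trans (bump_le s z); rewrite ler_piMl// cos_max.
Qed.

(* Multiplying by one more bump replaces [cos a] by a combination of five
   cosines, in which the weight of the new variable is [0], [6/5], [-6/5], [12/5] or [-12/5]. *)
Lemma Rintegral_cos_bump_le s (w : T -> R) : uniq s -> {subset s <= I} ->
  (forall i, i \in s -> w i = 0) ->
  `|\int[P]_z (cos (lin w z) * bump s z)| <=
  q ^+ size s * expR (- (c * \sum_(i in I) w i ^+ 2)).
Proof.
elim: s w => [|i s IH] w.
  move=> _ _ _; rewrite expr0 mul1r; apply: le_trans (charfun_le w).
  by under eq_Rintegral do rewrite /bump big_nil mulr1.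
rewrite cons_uniq => /andP[is_ us] sI w0.
have iI : i \in I by apply: sI; rewrite mem_head.
have wi : w i = 0 by apply: w0; rewrite mem_head.
(* The weight [k] is put on the variable [i], where [w] vanishes, so [k ^+ 2] is simply added to the
   sum of squares. *)
pose upd k j := w j + (j == i)%:R * k.
pose J k := \int[P]_z (cos (lin (upd k) z) * bump s z).
have linU k z : lin (upd k) z = lin w z + k * xi i z.
  rewrite /lin (bigD1 i)//= [in RHS](bigD1 i)//= /upd eqxx wi mul1r mul0r !add0r addrC.
  congr (_ + _); apply: eq_bigr => j /andP[_ /negbTE ->].
  by rewrite mul0r addr0.
have sqrU k : \sum_(j in I) upd k j ^+ 2 = \sum_(j in I) w j ^+ 2 + k ^+ 2.
  rewrite (bigD1 i)//= [in RHS](bigD1 i)//= /upd eqxx wi mul1r expr0n /= !add0r addrC.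
  congr (_ + _); apply: eq_bigr => j /andP[_ /negbTE ->].
  by rewrite mul0r addr0.
have Jle k : `|J k| <= q ^+ size s * expR (- (c * \sum_(i in I) w i ^+ 2)) * expR (- (c * k ^+ 2)).
  rewrite -mulrA -expRD -opprD -mulrDr -sqrU; apply: IH => //.
    by move=> j js; apply: sI; rewrite inE js orbT.
  move=> j js; rewrite /upd w0 ?inE ?js ?orbT// add0r.
  by rewrite (_ : (j == i) = false) ?mul0r//; apply: contraNF is_ => /eqP <-.
have -> : \int[P]_z (cos (lin w z) * bump (i :: s) z) =
    7 / 10 * J 0 + (1 / 4 * J (6 / 5) + (1 / 4 * J (- (6 / 5)) +
    (- (1 / 10) * J (12 / 5) + - (1 / 10) * J (- (12 / 5))))).
  transitivity (\int[P]_z (7 / 10 * (cos (lin (upd 0) z) * bump s z) +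
    (1 / 4 * (cos (lin (upd (6 / 5)) z) * bump s z) +
    (1 / 4 * (cos (lin (upd (- (6 / 5))) z) * bump s z) +
    (- (1 / 10) * (cos (lin (upd (12 / 5)) z) * bump s z) +
     - (1 / 10) * (cos (lin (upd (- (12 / 5))) z) * bump s z)))))).
    apply: eq_Rintegral => z _; rewrite /bump big_cons mulrA trig_bump_cos !linU mul0r addr0.
    by ring.
  have i5 : P.-integrable setT
     (EFin \o (fun z => - (1 / 10) * (cos (lin (upd (- (12 / 5))) z) * bump s z))).
    by rewrite /comp; under eq_fun do rewrite EFinM; apply: integrableZl => //; exact: icos.
  have [i4 e4] := Rintegral_linear _ _ (- (1 / 10)) (icos (upd (12 / 5)) s) i5.
  have [i3 e3] := Rintegral_linear _ _ (1 / 4) (icos (upd (- (6 / 5))) s) i4.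
  have [i2 e2] := Rintegral_linear _ _ (1 / 4) (icos (upd (6 / 5)) s) i3.
  have [i1 e1] := Rintegral_linear _ _ (7 / 10) (icos (upd 0) s) i2.
  by rewrite e1 e2 e3 e4 RintegralZl.
have j0 := Jle 0; have j1 := Jle (6 / 5); have j2 := Jle (- (6 / 5)).
have j3 := Jle (12 / 5); have j4 := Jle (- (12 / 5)).
move: j0 j1 j2 j3 j4; rewrite !sqrrN expr0n /= mulr0 oppr0 expR0 mulr1 -rE.
have -> : expR (- (c * (12 / 5) ^+ 2)) = r ^+ 4.
  by rewrite rE -expRM_natl; congr expR; field.
set M := _ * expR _; rewrite /= (exprS q) -(mulrA q) -/M !ler_norml => /andP[? ?] /andP[? ?] /andP[? ?] /andP[? ?] /andP[? ?].
by rewrite /q; apply/andP; split; lra.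
Qed.

Lemma probability_bump_le (E : set Omega) : measurable E ->
  (forall z, E z -> forall i, i \in I -> `|xi i z| <= 1) ->
  (P E <= (q ^+ #|I|)%:E)%E.
Proof.
move=> mE hE.
have PE : P E = (\int[P]_z \1_E z)%:E.
  by rewrite /Rintegral integral_indic// setIT fineK// fin_num_measure.
rewrite PE lee_fin.
have h := @Rintegral_cos_bump_le (enum I) (fun=> 0) (enum_uniq _).
have i0 := icos (fun=> 0) (enum I).
(* With zero weights the cosine is [1], and the product of bumps dominates the indicator of [E]: all
   factors are at least [1] on [E] and nonnegative elsewhere. *)
apply: (@le_trans _ _ (\int[P]_z (cos (lin (fun=> 0) z) * bump (enum I) z))).
  apply: le_Rintegral => //.
    apply: (@integrable_bounded _ 1); first exact: measurable_indic.
    by move=> z; rewrite indicE; case: (z \in E); rewrite ?normr1 ?normr0.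
  move=> z _; rewrite /lin big1 ?cos0 ?mul1r; last by move=> i _; rewrite mul0r.
  rewrite indicE; case: (boolP (z \in E)) => [|_]; last exact: bump_ge0.
  rewrite inE => /hE zE /=; rewrite /bump big_enum /=.
  have -> : 1%:R = \prod_(i in I) (1 : R) by rewrite big1_eq.
  by apply: ler_prod => i iI; rewrite ler01 trig_bump_ge1// zE.
apply: (le_trans (ler_norm _)); apply: (le_trans (h _ _)) => //.
  by move=> i; rewrite mem_enum.
rewrite -cardE big1 ?mulr0 ?oppr0 ?expR0 ?mulr1//.
by move=> i _; rewrite expr0n.
Qed.

End product.

(** * Increments of the process *)

Section span.
Context {d} {Omega : measurableType d} {R : realType} (P : probability Omega R).
Implicit Types (X : R -> Omega -> R) (S : Omega -> R).

(** The pairs are (coefficient, time). With lists, a linear combination of such combinations is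
    again one, by concatenation. *)
Definition process_comb X (s : seq (R * R)) (z : Omega) : R :=
  \sum_(p <- s) p.1 * X p.2 z.

Lemma process_comb_sum X (T : finType) (I : {set T}) (w : T -> R)
    (s : T -> seq (R * R)) :
  exists s', forall z,
    process_comb X s' z = \sum_(i in I) w i * process_comb X (s i) z.
Proof.
exists (flatten [seq [seq (w i * p.1, p.2) | p <- s i] | i <- enum I]) => z.
rewrite /process_comb big_flatten /= big_map big_enum_cond /=.
rewrite (eq_bigl (mem I)) => [|i]; last by rewrite andbT.
apply: eq_bigr => i _; rewrite big_map mulr_sumr.
by apply: eq_bigr => p _; rewrite mulrA.
Qed.

(** The variance that the definition of a Gaussian process only asserts to exist is identified with
    the second moment. *)
Lemma centered_gaussian_comb X s : centered_gaussian_process P X ->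
  [/\ measurable_fun setT (process_comb X s),
      P.-integrable setT (EFin \o (fun z => process_comb X s z ^+ 2)) &
      \int[P]_z cos (process_comb X s z) =
      expR (- (\int[P]_z (process_comb X s z ^+ 2) / 2))].
Proof.
move=> [mX gX].
have mS : measurable_fun setT (process_comb X s).
  apply: measurable_sum => p; apply: measurable_funM; last exact: mX.
  exact: measurable_cst.
have [v [v0 law]] := gX (size s) (fun i => (nth (0, 0) s i).2) (fun i => (nth (0, 0) s i).1).
have lawS A : measurable A -> P (process_comb X s @^-1` A) = centered_gauss_law v A.
  move=> mA; rewrite -law// [process_comb X s](_ : _ = fun z =>
    \sum_(i < size s) (nth (0, 0) s i).1 * X (nth (0, 0) s i).2 z)//.
  by apply/funext => z; rewrite /process_comb (big_nth (0, 0)) big_mkord.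
have [i2 e2] := gauss_law_sqr P _ _ mS v0 lawS.
by split => //; rewrite e2; exact: (gauss_law_cos P _ _ mS v0 lawS).
Qed.

(** The arithmetic-geometric mean inequality takes the place of Cauchy-Schwarz; for unit second
    moments it also gives the bound [1]. *)
Lemma integrable_mul_sqr (f g : Omega -> R) :
  measurable_fun setT f -> measurable_fun setT g ->
  P.-integrable setT (EFin \o (fun z => f z ^+ 2)) ->
  P.-integrable setT (EFin \o (fun z => g z ^+ 2)) ->
  P.-integrable setT (EFin \o (fun z => f z * g z)) /\
  `|\int[P]_z (f z * g z)| <=
  (\int[P]_z (f z ^+ 2) + \int[P]_z (g z ^+ 2)) / 2.
Proof.
move=> mf mg if2 ig2.
have amgm z : `|f z * g z| <= 1 / 2 * f z ^+ 2 + 1 / 2 * g z ^+ 2.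
  rewrite ler_norml; have := sqr_ge0 (f z - g z); have := sqr_ge0 (f z + g z).
  by rewrite sqrrB sqrrD => h1 h2; apply/andP; split; lra.
have ig2' : P.-integrable setT (EFin \o (fun z => 1 / 2 * g z ^+ 2)).
  by rewrite /comp; under eq_fun do rewrite EFinM; apply: integrableZl => //.
have [ih eh] := Rintegral_linear _ _ _ (1 / 2) if2 ig2'.
have ifg : P.-integrable setT (EFin \o (fun z => f z * g z)).
  apply: le_integrable ih => //; first by apply/measurable_EFinP/measurable_funM.
  by move=> z _ /=; rewrite lee_fin (le_trans (amgm z))// ler_norm.
split => //; apply: (le_trans (le_normr_Rintegral measurableT ifg)).
have -> : (\int[P]_z f z ^+ 2 + \int[P]_z g z ^+ 2) / 2 =
    \int[P]_z (1 / 2 * f z ^+ 2 + 1 / 2 * g z ^+ 2).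
  by rewrite eh RintegralZl//; field.
by apply: le_Rintegral => //; exact: integrable_norm.
Qed.

Lemma Rintegral_sum (T : Type) (s : seq T) (F : T -> Omega -> R) :
  (forall i, P.-integrable setT (EFin \o F i)) ->
  P.-integrable setT (EFin \o (fun z => \sum_(i <- s) F i z)) /\
  \int[P]_z (\sum_(i <- s) F i z) = \sum_(i <- s) \int[P]_z F i z.
Proof.
move=> iF; elim: s => [|i s [IH1 IH2]].
  rewrite big_nil; under eq_Rintegral do rewrite big_nil.
  rewrite Rintegral_probability_cst; split=> //; rewrite /comp.
  by under eq_fun do rewrite big_nil; exact: integrable0.
have [h1 h2] := Rintegral_linear _ _ _ 1 (iF i) IH1.
have e : (fun z => \sum_(j <- i :: s) F j z) = (fun z => 1 * F i z + \sum_(j <- s) F j z).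
  by apply/funext => z; rewrite big_cons mul1r.
by rewrite e; split=> //; rewrite h2 mul1r IH2 big_cons.
Qed.

Lemma Rintegral_sqr_comb (T : finType) (I : {set T}) (xi : T -> Omega -> R) (w : T -> R) :
  (forall i, measurable_fun setT (xi i)) ->
  (forall i, P.-integrable setT (EFin \o (fun z => xi i z ^+ 2))) ->
  \int[P]_z ((\sum_(i in I) w i * xi i z) ^+ 2) =
  \sum_(i in I) \sum_(j in I) w i * w j * \int[P]_z (xi i z * xi j z).
Proof.
move=> mxi ixi.
have ixx i j : P.-integrable setT (EFin \o (fun z => xi i z * xi j z)).
  by have [] := integrable_mul_sqr _ _ (mxi i) (mxi j) (ixi i) (ixi j).
have iwxx i j : P.-integrable setT (EFin \o (fun z => w i * w j * (xi i z * xi j z))).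
  by rewrite /comp; under eq_fun do rewrite EFinM; apply: integrableZl => //; exact: ixx.
have inner i := Rintegral_sum _ (enum I) (fun j z => w i * w j * (xi i z * xi j z)) (iwxx i).
have [_] := Rintegral_sum _ (enum I)
  (fun i z => \sum_(j <- enum I) w i * w j * (xi i z * xi j z)) (fun i => (inner i).1).
rewrite big_enum /= => outer.
transitivity (\int[P]_z (\sum_(i <- enum I) \sum_(j <- enum I) w i * w j * (xi i z * xi j z))).
  apply: eq_Rintegral => z _; rewrite big_enum expr2 mulr_suml.
  apply: eq_bigr => i _; rewrite mulr_sumr big_enum; apply: eq_bigr => j _.
  by rewrite mulrACA.
rewrite outer; apply: eq_bigr => i _; rewrite (inner i).2 big_enum.
by apply: eq_bigr => j _; rewrite RintegralZl.
Qed.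

End span.

(** * Correlations of the normalized increments *)

Section increments.
Context {d} {Omega : measurableType d} {R : realType} (P : probability Omega R).
Variables (X : R -> Omega -> R) (gamma : R -> R).
Hypotheses (gX : centered_gaussian_process P X)
  (sX : stationary_with_cov P X gamma) (gamma0 : gamma 0 = 1).

Let X_comb t : X t = process_comb X [:: (1, t)].
Proof. by apply/funext => z; rewrite /process_comb big_seq1 mul1r. Qed.

Let iXX s t : P.-integrable setT (EFin \o (fun z => X s z * X t z)).
Proof.
rewrite (X_comb s) (X_comb t).
have [m1 i1 _] := centered_gaussian_comb P _ [:: (1, s)] gX.
have [m2 i2 _] := centered_gaussian_comb P _ [:: (1, t)] gX.
by have [] := integrable_mul_sqr P _ _ m1 m2 i1 i2.
Qed.

Lemma Rintegral_cov s t : \int[P]_z (X s z * X t z) = gamma (t - s).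
Proof. by have := sX s t; rewrite unlock /Rintegral => ->. Qed.

Lemma cov_even t : gamma (- t) = gamma t.
Proof.
have := Rintegral_cov 0 t; rewrite subr0 => <-.
have := Rintegral_cov t 0; rewrite sub0r => <-.
by apply: eq_Rintegral => z _; rewrite mulrC.
Qed.

Variables (b : R).
Hypothesis gb1 : gamma b < 1.

Let s2 := 2 * (1 - gamma b).
Let s2_gt0 : 0 < s2.
Proof. by rewrite mulr_gt0// subr_gt0. Qed.

Definition norm_incr (i : nat) (z : Omega) : R :=
  (X (i.+1%:R * b) z - X (i%:R * b) z) / Num.sqrt (2 * (1 - gamma b)).

Let incr_seq (i : nat) : seq (R * R) :=
  [:: ((Num.sqrt s2)^-1, i.+1%:R * b); (- (Num.sqrt s2)^-1, i%:R * b)].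

Lemma norm_incr_comb i : norm_incr i = process_comb X (incr_seq i).
Proof.
apply/funext => z; rewrite /process_comb big_cons big_seq1 /norm_incr /= -/s2.
by rewrite mulrBl mulNr ![_^-1 * _]mulrC.
Qed.

(** The product expands into four covariances. The lag [j%:R - i%:R] is taken in [R], so it may be
    negative and both orders of [i] and [j] are covered. *)
Lemma norm_incr_corr i j : \int[P]_z (norm_incr i z * norm_incr j z) =
  (2 * gamma ((j%:R - i%:R) * b) - gamma ((j%:R - i%:R - 1) * b) -
   gamma ((j%:R - i%:R + 1) * b)) / (2 * (1 - gamma b)).
Proof.
have i4 : P.-integrable setT (EFin \o (fun z => s2^-1 * (X (i%:R * b) z * X (j%:R * b) z))).
  by rewrite /comp; under eq_fun do rewrite EFinM; apply: integrableZl => //; exact: iXX.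
have [i3 e3] := Rintegral_linear _ _ _ (- s2^-1) (iXX (i%:R * b) (j.+1%:R * b)) i4.
have [i2 e2] := Rintegral_linear _ _ _ (- s2^-1) (iXX (i.+1%:R * b) (j%:R * b)) i3.
have [i1 e1] := Rintegral_linear _ _ _ (s2^-1) (iXX (i.+1%:R * b) (j.+1%:R * b)) i2.
transitivity (\int[P]_z (s2^-1 * (X (i.+1%:R * b) z * X (j.+1%:R * b) z) +
   (- s2^-1 * (X (i.+1%:R * b) z * X (j%:R * b) z) +
   (- s2^-1 * (X (i%:R * b) z * X (j.+1%:R * b) z) +
    s2^-1 * (X (i%:R * b) z * X (j%:R * b) z))))).
  apply: eq_Rintegral => z _; rewrite /norm_incr -/s2 mulrACA -invfM -expr2.
  by rewrite sqr_sqrtr ?ltW//; ring.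
rewrite e1 e2 e3 RintegralZl// !Rintegral_cov -/s2.
have -> : j.+1%:R * b - i.+1%:R * b = (j%:R - i%:R) * b by rewrite -!natr1; ring.
have -> : j%:R * b - i.+1%:R * b = (j%:R - i%:R - 1) * b by rewrite -!natr1; ring.
have -> : j.+1%:R * b - i%:R * b = (j%:R - i%:R + 1) * b by rewrite -!natr1; ring.
have -> : j%:R * b - i%:R * b = (j%:R - i%:R) * b by ring.
by field; rewrite gt_eqF.
Qed.

Lemma norm_incr_corr1 i : \int[P]_z (norm_incr i z ^+ 2) = 1.
Proof.
under eq_Rintegral do rewrite expr2.
rewrite norm_incr_corr subrr mul0r sub0r add0r mulN1r mul1r cov_even gamma0.
rewrite (_ : 2 * 1 - gamma b - gamma b = 2 * (1 - gamma b)); last by ring.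
by rewrite divff// gt_eqF.
Qed.

Lemma norm_incr_corrC i j : \int[P]_z (norm_incr i z * norm_incr j z) =
  \int[P]_z (norm_incr j z * norm_incr i z).
Proof. by apply: eq_Rintegral => z _; rewrite mulrC. Qed.

Lemma norm_incr_corr_le1 i j : `|\int[P]_z (norm_incr i z * norm_incr j z)| <= 1.
Proof.
have [m1 i1 _] := centered_gaussian_comb P _ (incr_seq i) gX.
have [m2 i2 _] := centered_gaussian_comb P _ (incr_seq j) gX.
have [_] := integrable_mul_sqr P _ _ m1 m2 i1 i2.
by rewrite -!norm_incr_comb !norm_incr_corr1 (_ : (1 + 1) / 2 = 1)//; field.
Qed.

Lemma measurable_norm_incr i : measurable_fun setT (norm_incr i).
Proof.
by rewrite norm_incr_comb; have [] := centered_gaussian_comb P _ (incr_seq i) gX.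
Qed.

Lemma norm_incr_charfun (T : finType) (I : {set T}) (t : T -> nat) (w : T -> R) :
  \int[P]_z cos (\sum_(i in I) w i * norm_incr (t i) z) =
  expR (- ((\sum_(i in I) \sum_(j in I)
    w i * w j * \int[P]_z (norm_incr (t i) z * norm_incr (t j) z)) / 2)).
Proof.
have [s hs] := process_comb_sum X _ I w (fun i => incr_seq (t i)).
have [_ _] := centered_gaussian_comb P _ s gX.
have e z : process_comb X s z = \sum_(i in I) w i * norm_incr (t i) z.
  by rewrite hs; apply: eq_bigr => i _; rewrite norm_incr_comb.
under eq_Rintegral do rewrite e; move=> ->.
under eq_Rintegral do rewrite e.
rewrite Rintegral_sqr_comb// => i; first exact: measurable_norm_incr.
rewrite norm_incr_comb.
by have [] := centered_gaussian_comb P _ (incr_seq (t i)) gX.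
Qed.

End increments.

(** * Row sums and the function p *)

Lemma ler_sum_natr (R : realDomainType) (f : nat -> R) (m n p : nat) :
  (forall k, 0 <= f k) -> (n <= p)%N ->
  \sum_(m <= k < n) f k <= \sum_(m <= k < p) f k.
Proof.
move=> f0 np; case: (leqP m n) => mn; last first.
  by rewrite big_geq ?(ltnW mn)// sumr_ge0.
by rewrite (big_cat_nat mn np) /= lerDl sumr_ge0.
Qed.

(** With truncated subtraction, [(i - j) + (j - i)] is the distance of [i] and [j]. The indices on
    either side of [i] contribute distinct lags, all between [1] and [N - 1]. *)
Lemma toeplitz_row_sum_le (R : realDomainType) (r : nat -> R) (N i : nat) :
  (forall k, 0 <= r k) -> (i < N)%N ->
  \sum_(0 <= j < N | j != i) r ((i - j) + (j - i))%N <=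
  2 * \sum_(1 <= k < N) r k.
Proof.
move=> r0 iN; rewrite (big_cat_nat (leq0n i) (ltnW iN)) /=.
rewrite [X in _ + X]big_mkcond [X in _ + X]big_ltn// eqxx /= add0r -big_mkcond /=.
have -> : \sum_(0 <= j < i | j != i) r (i - j + (j - i))%N = \sum_(1 <= k < i.+1) r k.
  rewrite big_add1 /= big_nat_rev /= big_nat_cond [RHS]big_nat_cond.
  apply: eq_big => [j|j /andP[/andP[_ ji] _]]; last by congr r; lia.
  by rewrite add0n !andbT; case: (ltnP j i) => //= ji; apply/eqP; lia.
have -> : \sum_(i.+1 <= j < N | j != i) r (i - j + (j - i))%N = \sum_(1 <= k < N - i) r k.
  rewrite -[i.+1]add1n big_addn big_nat_cond [RHS]big_nat_cond.
  apply: eq_big => [j|j /andP[/andP[j1 _] _]]; last by congr r; lia.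
  by case: (ltnP 0 j) => //= j0; case: (ltnP j (N - i)) => //= _; apply/eqP; lia.
rewrite mulr_natl mulr2n; apply: lerD; apply: ler_sum_natr => //; lia.
Qed.

(** The general term of the series in [p_fun]; for [1 <= j] it is the absolute correlation of two
    increments at lag [j]. *)
Definition second_diff_ratio {R : realType} (gamma : R -> R) (b : R) (j : nat) : R :=
  `|2 * gamma (j%:R * b) - gamma ((j.-1)%:R * b) - gamma (j.+1%:R * b)|
    / (2 * (1 - gamma b)).

Section p_fun.
Variables (R : realType) (gamma : R -> R) (b : R).
Hypotheses (gb1 : gamma b < 1) (sb : abs_summable_at gamma b).

Lemma second_diff_ratio_ge0 j : 0 <= second_diff_ratio gamma b j.
Proof. by rewrite divr_ge0// mulr_ge0// subr_ge0 ltW. Qed.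

(** The limit in [p_fun] bounds the nondecreasing partial sums only if it exists. Absolute
    summability of [gamma] supplies this: each of the three shifted sums is controlled by [L], with
    weights [2], [1] and [1]. *)
Lemma second_diff_sum_le n :
  \sum_(2 <= j < n) second_diff_ratio gamma b j <= p_fun gamma b - 1.
Proof.
set u := fun n => \sum_(2 <= j < n) second_diff_ratio gamma b j.
have -> : p_fun gamma b - 1 = limn u by rewrite /p_fun addrC addKr.
have ndu : nondecreasing_seq u.
  by move=> m k mk; apply: ler_sum_natr => // j; exact: second_diff_ratio_ge0.
apply: (nondecreasing_cvgn_le ndu).
pose f k : R := `|gamma (k%:R * b)|.
have f0 k : 0 <= f k by exact: normr_ge0.
have ndf : nondecreasing_seq (fun n => \sum_(1 <= j < n) f j).
  by move=> m k mk; apply: ler_sum_natr => // i; rewrite normr_ge0.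
pose L := limn (fun n => \sum_(1 <= j < n) f j).
have fL k : \sum_(1 <= j < k) f j <= L by exact: nondecreasing_cvgn_le ndf sb k.
apply: nondecreasing_is_cvgn => //; exists ((2 * L + L + L) / (2 * (1 - gamma b))).
move=> _ [m _ <-]; rewrite /u /second_diff_ratio -mulr_suml ler_wpM2r//.
  by rewrite invr_ge0 mulr_ge0// subr_ge0 ltW.
apply: (@le_trans _ _ (\sum_(2 <= j < m) (2 * f j + f j.-1 + f j.+1))).
  apply: ler_sum => j _; apply: (le_trans (ler_normB _ _)); apply: lerD => //.
  by apply: (le_trans (ler_normB _ _)); apply: lerD => //; rewrite normrM normr_nat.
rewrite !big_split /= -mulr_sumr; apply: lerD; first apply: lerD.
- rewrite ler_wpM2l//; apply: le_trans (fL m).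
  case: (ltnP 1 m) => m1; last by rewrite big_geq; [apply: sumr_ge0|lia].
  by rewrite [leRHS]big_ltn// lerDr.
- by rewrite big_add1; apply: le_trans (fL m.-1).
- apply: le_trans (fL m.+1).
  have -> : \sum_(2 <= j < m) f j.+1 = \sum_(3 <= k < m.+1) f k by rewrite [RHS]big_add1.
  case: (ltnP 2 m.+1) => m1; last by rewrite big_geq; [apply: sumr_ge0|lia].
  by rewrite [leRHS]big_ltn ?(ltn_trans _ m1)// [X in _ <= _ + X]big_ltn// addrA lerDr addr_ge0.
Qed.

Lemma p_fun_ge1 : 1 <= p_fun gamma b.
Proof. by have := second_diff_sum_le 2; rewrite big_geq// subr_ge0. Qed.

End p_fun.

(** * Measurability of the small-oscillation event *)

Lemma closed_sub_rat_setT (R : realType) (C : set R) :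
  closed C -> (forall q : rat, C (ratr q)) -> forall x, C x.
Proof.
move=> cC Cq x; apply: contrapT => Cx.
have C0 : ~` C !=set0 by exists x.
have [y [/= nCy [q _ qy]]] := dense_rat C0 (closed_openC cC).
by apply: nCy; rewrite -qy.
Qed.

(** Path continuity reduces the condition to countably many pairs of times. Rational times are first
    truncated to the interval, so that density in the whole line suffices and a possibly irrational
    endpoint [T] causes no trouble. *)
Lemma measurable_oscillation_le {d} {Omega : measurableType d} {R : realType}
  (X : R -> Omega -> R) (T a : R) :
  (forall t, measurable_fun setT (X t)) -> continuous_paths X -> 0 < T ->
  measurable [set w | forall s t : R, (0 <= s <= T)%R -> (0 <= t <= T)%R ->
                    (`|X s w - X t w| <= a)%R].
Proof.
move=> mX cX T0.
(* [h] truncates time to [[0, T]]. *)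
pose h (x : R) : R := (`|x| - `|x - T| + T) / 2.
have ch : continuous h.
  move=> x; apply: cvgM; last exact: cvg_cst.
  apply: cvgD; last exact: cvg_cst.
  apply: cvgB; apply: cvg_norm; first exact: cvg_id.
  by apply: cvgB; [exact: cvg_id|exact: cvg_cst].
have h_id x : 0 <= x <= T -> h x = x.
  move=> /andP[x0 xT]; rewrite /h ger0_norm// ler0_norm ?subr_le0//; lra.
have h_in x : 0 <= h x <= T.
  rewrite /h; have [x0|x0] := ger0P x; have [xT|xT] := ger0P (x - T);
    apply/andP; split; lra.
have cXh w : continuous (fun s => X (h s) w).
  by move=> s; apply: (@continuous_comp _ _ _ h (fun t => X t w)); [exact: ch|exact: cX].
pose E (p : rat * rat) := [set w | `|X (h (ratr p.1)) w - X (h (ratr p.2)) w| <= a].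
rewrite [X in measurable X](_ : _ = \bigcap_(p in [set: rat * rat])
  E p); last first.
  apply/seteqP; split => w /= H.
    by move=> p _; apply: H.
  (* The passage from rational to real times is made one variable at a time. *)
  have H1 : forall q : rat, forall t : R, `|X (h (ratr q)) w - X (h t) w| <= a.
    move=> q; apply: (@closed_sub_rat_setT _
      ((fun t => `|X (h (ratr q)) w - X (h t) w|) @^-1` [set y | y <= a])) => [|q'].
      apply: preimage_closed; last exact: closed_le.
      by move=> t _; apply: cvg_norm; apply: cvgB; [exact: cvg_cst|exact: cXh].
    exact: (H (q, q') I).
  have H2 : forall t s : R, `|X (h s) w - X (h t) w| <= a.
    move=> t; apply: (@closed_sub_rat_setT _
      ((fun s => `|X (h s) w - X (h t) w|) @^-1` [set y | y <= a])) => [|q'].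
      apply: preimage_closed; last exact: closed_le.
      by move=> s _; apply: cvg_norm; apply: cvgB; [exact: cXh|exact: cvg_cst].
    exact: H1.
  by move=> s t s0 t0; rewrite -(h_id s s0) -(h_id t t0).
have mE p : measurable (E p).
  rewrite (_ : E p = (fun w => `|X (h (ratr p.1)) w - X (h (ratr p.2)) w|) @^-1` `]-oo, a]).
    rewrite -[X in measurable X]setTI; apply: measurableT_comp => //.
    exact: measurable_funB.
  by apply/seteqP; split => w /=; rewrite in_itv.
rewrite (_ : \bigcap_(p in _) _ = \bigcap_(n in [set: nat])
    (if unpickle n is Some p then E p else setT)).
  by apply: bigcap_measurableType => n _; case: unpickle.
apply/seteqP; split => w H.
  by move=> n _; case: unpickle => // p; exact: H.
by move=> p _; have := H (pickle p) I; rewrite pickleK.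
Qed.

(** * The small deviation bound *)

(** The exponent [63/100] is cut into four quarters before [1 + x <= expR x] is applied; the cruder
    bound from one or two pieces would not bring the sum below [1]. *)
Lemma bump_ratio_le (R : realType) (r : R) : r = expR (- (7 / 16 * (6 / 5) ^+ 2)) ->
  7 / 10 + r / 2 + r ^+ 4 / 5 <= 999 / 1000.
Proof.
pose e : R := expR (63 / 400).
have re : (7 / 16 * (6 / 5) ^+ 2 = 63 / 400 *+ 4 :> R) by field.
have e1 : 463 / 400 <= e by have := expR_ge1Dx (63 / 400 : R); rewrite -/e; lra.
have e2 : 1339 / 1000 <= e * e.
  apply: (@le_trans _ _ (463 / 400 * (463 / 400))); first lra.
  by apply: ler_pM; lra.
have e4 : 1792 / 1000 <= e ^+ 4.
  rewrite (_ : e ^+ 4 = e * e * (e * e)); last by ring.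
  clear e1 re.
  apply: (@le_trans _ _ (1339 / 1000 * (1339 / 1000))); first by clear e2; lra.
  by apply: ler_pM; lra.
move=> rE.
have rE4 : r * e ^+ 4 = 1.
  rewrite rE re expRN -mulr_natl expRM_natl; apply: mulVf; apply: expf_neq0.
  by apply: lt0r_neq0; exact: expR_gt0.
have r0 : 0 <= r by rewrite rE expR_ge0.
clear rE re e1 e2.
have r1 : r <= 1117 / 2000.
  have h : r * (1792 / 1000) <= 1 by rewrite -[leRHS]rE4 ler_wpM2l.
  by clear rE4 e4; lra.
clear rE4 e4 e.
have r2 : r * r <= 312 / 1000.
  apply: (@le_trans _ _ (1117 / 2000 * (1117 / 2000))); first by apply: ler_pM; lra.
  by clear r1; lra.
have r4 : r ^+ 4 <= 975 / 10000.
  rewrite (_ : r ^+ 4 = r * r * (r * r)); last by ring.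
  apply: (@le_trans _ _ (312 / 1000 * (312 / 1000))).
    by apply: ler_pM; [exact: mulr_ge0|exact: mulr_ge0|exact: r2|exact: r2].
  by clear r1 r2; lra.
by clear r2; lra.
Qed.

Section row_sums.
Context {d} {Omega : measurableType d} {R : realType} (P : probability Omega R).
Variables (X : R -> Omega -> R) (gamma : R -> R).
Hypotheses (gX : centered_gaussian_process P X)
  (sX : stationary_with_cov P X gamma) (gamma0 : gamma 0 = 1).
Variables (b : R).
Hypotheses (gb1 : gamma b < 1) (sb : abs_summable_at gamma b).

Let xi := norm_incr X gamma b.

Lemma norm_incr_corrE i j : i != j ->
  `|\int[P]_z (xi i z * xi j z)| =
  second_diff_ratio gamma b ((i - j) + (j - i))%N.
Proof.
wlog ij : i j / (i < j)%N.
  move=> H ij; have [lt|lt|e] := ltngtP i j; first exact: H.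
    by rewrite [in LHS]norm_incr_corrC [in RHS]addnC; apply: H => //; rewrite eq_sym.
  by rewrite e eqxx in ij.
move=> _; rewrite (norm_incr_corr P _ _ gX sX _ gb1) /second_diff_ratio.
have -> : (i - j + (j - i))%N = (j - i)%N by lia.
have -> : j%:R - i%:R = (j - i)%:R :> R by rewrite natrB// ltnW.
have -> : (j - i)%:R - 1 = (j - i).-1%:R :> R by rewrite -[in LHS](@prednK (j - i)) ?subn_gt0// -natr1 addrK.
have -> : (j - i)%:R + 1 = (j - i).+1%:R :> R by rewrite natr1.
rewrite normrM normfV [X in _ / X]ger0_norm//.
by rewrite mulr_ge0// subr_ge0 ltW.
Qed.

Lemma norm_incr_row_sum_le (N i : nat) : (i < N)%N ->
  \sum_(j < N) (if i == j then 0 else `|\int[P]_z (xi i z * xi j z)|) <=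
  2 * p_fun gamma b.
Proof.
move=> iN; rewrite -(big_mkord xpredT
  (fun j => if i == j then 0 else `|\int[P]_z (xi i z * xi j z)|)).
have -> : \sum_(0 <= j < N) (if i == j then 0 else `|\int[P]_z (xi i z * xi j z)|) =
    \sum_(0 <= j < N | j != i) second_diff_ratio gamma b ((i - j) + (j - i))%N.
  rewrite [RHS]big_mkcond; apply: eq_bigr => j _; rewrite [j == i]eq_sym.
  by have [//|ij] := eqVneq i j; rewrite norm_incr_corrE.
apply: (le_trans (toeplitz_row_sum_le _ _ _ _ (second_diff_ratio_ge0 _ _ _ gb1) iN)).
rewrite ler_wpM2l//.
(* The series in [p_fun] starts at lag [2]; the correlation at lag [1] is paid for by its leading
   [1]. *)
have h1 : second_diff_ratio gamma b 1 <= 1.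
  by rewrite -(@norm_incr_corrE 0 1)//; exact: (norm_incr_corr_le1 P _ _ gX sX gamma0 _ gb1).
case: (ltnP 1 N) => N1; last first.
  by rewrite big_geq// (le_trans ler01)// (p_fun_ge1 _ _ _ gb1 sb).
rewrite big_ltn//; have := second_diff_sum_le _ _ _ gb1 sb N; lra.
Qed.

Lemma small_increments_le (E : set Omega) (N : nat) : measurable E ->
  (forall z, E z -> forall i, (i < N)%N -> `|xi i z| <= 1) ->
  exists m : nat, N%:R <= (1 + 16 * p_fun gamma b) * m%:R /\
    (P E <= ((999 / 1000) ^+ m)%:E)%E.
Proof.
move=> mE hE.
pose A (i j : 'I_N) : R := if i == j :> nat then 0 else `|\int[P]_z (xi i z * xi j z)|.
pose Cr (i j : 'I_N) := \int[P]_z (xi i z * xi j z).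
have sA i j : A i j = A j i by rewrite /A eq_sym norm_incr_corrC.
have A0 i j : 0 <= A i j by rewrite /A; case: ifP.
have Ad i : A i i = 0 by rewrite /A eqxx.
have Arow i : \sum_j A i j <= 2 * p_fun gamma b by exact: norm_incr_row_sum_le.
(* With [eta = 1/8] and [B = 2 p], the cardinality bound multiplied by [8] reads
   [N <= (1 + 16 p) #|I|]. *)
have [I [rI cI]] := exists_sparse_subset _ _ _ _ (1 / 8) sA A0 Ad Arow.
exists #|I|; split; first by move: cI; rewrite card_ord; lra.
have Cd i : Cr i i = 1.
  by rewrite -(norm_incr_corr1 P _ _ gX sX gamma0 _ gb1 i); apply: eq_Rintegral => z _; rewrite expr2.
have CA i j : i != j -> `|Cr i j| <= A i j by rewrite /A -val_eqE /= => /negbTE ->.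
(* Here [7/16] is half of [1 - 1/8]: diagonal dominance gives [7/8], and the Gaussian characteristic
   function halves the variance. *)
pose r : R := expR (- (7 / 16 * (6 / 5) ^+ 2)).
have chf (w : 'I_N -> R) : `|\int[P]_z cos (\sum_(i in I) w i * xi i z)| <=
    expR (- (7 / 16 * \sum_(i in I) w i ^+ 2)).
  rewrite (norm_incr_charfun P _ _ gX) ger0_norm ?expR_ge0// ler_expR lerN2.
  have := diag_dominant_form_ge _ _ _ _ _ _ w sA Ad Cd CA rI.
  by rewrite /Cr /xi; lra.
have := probability_bump_le P _ (fun i : 'I_N => xi i) I (7 / 16) r
  (fun i => measurable_norm_incr P _ gamma gX b i) chf erefl E mE (fun z Ez i _ => hE z Ez i (ltn_ord i)).
move=> /le_trans; apply; rewrite lee_fin.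
have r0 : 0 <= r by exact: expR_ge0.
apply: lerXn2r; rewrite ?nnegrE; last exact: bump_ratio_le.
  by apply: addr_ge0; [apply: addr_ge0; [|exact: divr_ge0]|apply: divr_ge0; rewrite ?exprn_ge0//]; lra.
by lra.
Qed.

End row_sums.

Theorem mainTheorem1 (R : realType) :
  exists K : R, 0 < K /\
  forall (d : measure_display) (Omega : measurableType d)
         (P : probability Omega R) (X : R -> Omega -> R) (gamma : R -> R),
    centered_gaussian_process P X ->
    stationary_with_cov P X gamma ->
    continuous_paths X ->
    gamma 0 = 1 ->
    (forall b : R, 0 < b -> abs_summable_at gamma b) ->
    forall (T a eps : R), 0 < T -> 0 < a ->
      is_eps gamma a eps -> gamma eps < 1 -> eps <= T ->
      (P [set w | forall s t : R, (0 <= s <= T)%R -> (0 <= t <= T)%R ->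
                    (`|X s w - X t w| <= a)%R]
       <= (expR (- (K * T / (eps * p_fun gamma eps))))%:E)%E.
Proof.
(* The factor [1/1000] comes from [999/1000 <= expR (- 1/1000)], and [34 = 2 * 17] from
   [T / eps <= 2 N] together with [1 + 16 p <= 17 p]. *)
exists (1 / 1000 / 34); split; first lra.
move=> d Omega P X gamma gX sX cX gamma0 sum T a eps T0 a0 [eps0 [a_le _]] g1 epsT.
set E := [set w | _].
have mE : measurable E by apply: measurable_oscillation_le => //; case: gX.
have s0 : 0 < Num.sqrt (2 * (1 - gamma eps)).
  by rewrite sqrtr_gt0 mulr_gt0// subr_gt0.
have a_le_s : a <= Num.sqrt (2 * (1 - gamma eps)).
  (* The infimum defining [delta_fun] is at most its value at [u = 1], the standard deviation of one
     increment; [0] is a lower bound of the set. *)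
  apply: (le_trans a_le); apply: ge_inf; last by exists 1 => //=; rewrite mul1r.
  by exists 0 => _ [u _ <-]; exact: sqrtr_ge0.
have sume := sum _ eps0; have p1 := p_fun_ge1 _ _ _ g1 sume.
(* The number of full steps of length [eps] that fit in the interval. It is positive as [eps <= T],
   so that [T / eps < N + 1 <= 2 N]. *)
pose N := Num.truncn (T / eps).
have Te1 : 1 <= T / eps by rewrite ler_pdivlMr// mul1r.
have /andP[NT TN] : N%:R <= T / eps < N.+1%:R.
  by apply: truncn_itv; rewrite (le_trans ler01).
have N1 : (0 < N)%N by have := le_lt_trans Te1 TN; rewrite ltr1n ltnS.
have grid k : (k <= N)%N -> 0 <= k%:R * eps <= T.
  move=> kN; rewrite (mulr_ge0 (ler0n _ _) (ltW eps0)) /= -ler_pdivlMr//.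
  by apply: le_trans NT; rewrite ler_nat.
have hE z : E z -> forall i, (i < N)%N -> `|norm_incr X gamma eps i z| <= 1.
  move=> Ez i iN; rewrite /norm_incr normrM normfV (ger0_norm (ltW s0)).
  rewrite ler_pdivrMr// mul1r; apply: le_trans a_le_s; apply: Ez.
    by apply: grid; exact: iN.
  by apply: grid; exact: ltnW.
have [m [Nm PE]] := small_increments_le P _ _ gX sX gamma0 _ g1 sume E N mE hE.
apply: (le_trans PE); rewrite lee_fin.
have p0 : 0 < p_fun gamma eps by apply: lt_le_trans p1.
apply: (@le_trans _ _ (expR (- (1 / 1000)) ^+ m)).
  apply: lerXn2r; rewrite ?nnegrE; [lra|exact: expR_ge0|].
  by have := expR_ge1Dx (- (1 / 1000) : R); lra.
rewrite -expRM_natl ler_expR mulrN lerN2.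
rewrite invfM mulrA -(mulrA _ T) ler_pdivrMr//.
have N1R : 1 <= N%:R :> R by rewrite ler1n.
have h1 : T / eps <= 2 * N%:R by move: TN; rewrite -natr1; lra.
have h2 : (1 + 16 * p_fun gamma eps) * m%:R <= 17 * p_fun gamma eps * m%:R.
  by rewrite ler_wpM2r//; lra.
lra.
Qed.
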